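(* For all $r,n\ge0$ there is a bijection $w\mapsto(w_0,v_1,\dots,v_k)$ from $W_n(r)=\{0,\dots,r\}^n$ onto the set of sequences $(w_0,v_1,\dots,v_k)$ ($k\ge0$), where $w_0$ is a nondecreasing word over $\{0,\dots,r\}$, each $v_j$ is a $V$-word with letters at most $r$, and the total length is $n$, such that $w_0v_1v_2\cdots v_k$ is a rearrangement of $w$ and $\mathrm{dec}\,w=\mathrm{dec}\,v_1+\mathrm{dec}\,v_2+\cdots+\mathrm{dec}\,v_k$. (In words: to each word $w$ of nonnegative integers there corresponds a unique such sequence.)
   Context: A $V$-word is a word $x_1\cdots x_n$ of nonnegative integers, $n\ge2$, such that for some $1\le i\le n-1$: $x_1\ge\cdots\ge x_i>x_{i+1}$ and $x_{i+1}\le\cdots\le x_n<x_i$. For $w=x_1\cdots x_n$, $i\in\{1,\dots,n-1\}$ is a decrease if $x_i\ge x_{i+1}\ge\cdots\ge x_j>x_{j+1}$ for some $i\le j\le n-1$; $\mathrm{dec}\,w$ is the number of decreases. *)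

(* Defs.v *)
From HB Require Import structures.
From mathcomp Require Import all_boot.

Set Implicit Arguments.
Unset Strict Implicit.
Unset Printing Implicit Defensive.

(* A word x_1 ... x_n of nonnegative integers is a [seq nat]; since [nth]
   counts from 0, x_k is [nth 0 x k.-1]. *)

Definition words (r n : nat) : pred (seq nat) :=
  fun w => (size w == n) && all (fun a => a <= r) w.

(* [take i x] is x_1 ... x_i and [drop i x] is x_(i+1) ... x_n; the bound
   [i < size x] is i <= n - 1. *)
Definition V_word (x : seq nat) : bool :=
  (2 <= size x) &&
  [exists i : 'I_(size x),
    [&& 1 <= i, sorted geq (take i x), nth 0 x i.-1 > nth 0 x i,
        sorted leq (drop i x) & last 0 x < nth 0 x i.-1]].

(* The index [i : 'I_(n.-1)] stands for the position i + 1, and likewise [j];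
   [drop i (take j.+1 x)] is x_(i+1) ... x_(j+1). *)
Definition decrease (x : seq nat) (i : 'I_(size x).-1) : bool :=
  [exists j : 'I_(size x).-1,
    [&& i <= j, sorted geq (drop i (take j.+1 x)) & nth 0 x j > nth 0 x j.+1]].

Definition dec (x : seq nat) : nat := #|[set i | @decrease x i]|.

(* The pair (w0, [:: v_1; ...; v_k]) encodes (w_0, v_1, ..., v_k). *)
Definition V_sequences (r n : nat) : pred (seq nat * seq (seq nat)) :=
  fun p =>
    [&& sorted leq p.1, all (fun a => a <= r) p.1,
        all (fun v => V_word v && all (fun a => a <= r) v) p.2
      & size p.1 + \sum_(v <- p.2) size v == n].

(* Main.v *)
(* A V-word v = A B consists of a weakly decreasing word A and a weakly
   increasing word B, both nonempty, with every letter of A larger than every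
   letter of B, and dec v is the length of A.  It suffices to match the words
   that are not nondecreasing with the pairs (v, u) of a V-word and an arbitrary
   word, preserving letters and dec: iterating peels off v_1, ..., v_k and leaves
   w_0.  Let c be the largest letter of B and B = B' c.  Send (v, u) to B A u if
   the first position of c u is a decrease and to B' A c u otherwise.  Whether a
   position is a decrease depends only on the suffix starting there, so dec is
   additive.  Conversely the cuts can be read off the image: the first factor is
   its longest prefix of non-decreases, and A is the longest run of decreases
   after it whose letters exceed that prefix. *)

Require Import Defs.
From HB Require Import structures.
From mathcomp Require Import all_boot.

Set Implicit Arguments.
Unset Strict Implicit.
Unset Printing Implicit Defensive.

(** * Decreases, read off from suffixes *)

(* [falls x u]: the first position of [x :: u] is a decrease. *)
Fixpoint falls (x : nat) (u : seq nat) : bool :=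
  if u is y :: u' then (y < x) || (y == x) && falls y u' else false.

Fixpoint falls_count (w : seq nat) : nat :=
  if w is x :: u then falls x u + falls_count u else 0.

Lemma fallsP x u :
  reflect (exists j, [/\ j < size u, sorted geq (take j.+1 (x :: u))
                       & nth 0 (x :: u) j > nth 0 (x :: u) j.+1])
          (falls x u).
Proof.
elim: u x => [|y u IH] x; first by right; case=> j [].
apply: (iffP idP) => /= [/orP[yx|/andP[/eqP-> /IH[j [ju js jn]]]]|].
- by exists 0.
- by exists j.+1; split=> //; rewrite /= leqnn.
- case=> -[|j] [ju /=]; first by move=> _ ->.
  case/andP=> yx js jn; move: yx; rewrite leq_eqVlt => /predU1P[<-|-> //].
  by rewrite eqxx (introT (IH _)) ?orbT //; exists j.
Qed.

Lemma decrease_falls (w : seq nat) (i : 'I_(size w).-1) :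
  decrease i = falls (nth 0 w i) (drop i.+1 w).
Proof.
have wi : i < size w by case: w i => [[]|x w []] //= m /ltnW.
have dE : drop i w = nth 0 w i :: drop i.+1 w by rewrite -drop_nth.
apply/existsP/fallsP => [[j /and3P[ij sj nj]]|[j []]].
(* [fallsP] counts from the start of the suffix, hence the shift by [i]. *)
- exists (j - i); rewrite size_drop -dE !nth_drop addnS subnKC //.
  rewrite ltn_subRL addSn subnKC // -ltn_predRL ltn_ord.
  by rewrite take_drop addSn subnK.
- rewrite size_drop -dE !nth_drop addnS => jn sj nj.
  have ltj : i + j < (size w).-1 by rewrite ltn_predRL -addSn -ltn_subRL.
  exists (Ordinal ltj); rewrite /= leq_addr nj andbT.
  by rewrite -addnS addnC -take_drop.
Qed.

(** The last position of a word is never a decrease, so stopping one index short loses nothing. *)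
Lemma falls_count_sum w :
  falls_count w = \sum_(i < (size w).-1) falls (nth 0 w i) (drop i.+1 w).
Proof.
elim: w => [|x [|y u] IH]; rewrite ?big_ord0 //.
by rewrite [size _]/= big_ord_recl [LHS]/= -/(falls_count (y :: u)) IH.
Qed.

Lemma dec_falls_count w : dec w = falls_count w.
Proof.
rewrite falls_count_sum /dec -sum1_card big_mkcond.
by apply: eq_bigr => i _; rewrite inE decrease_falls; case: falls.
Qed.

(** * Longest prefixes satisfying a suffix condition *)

(* Every position of [s] satisfies [P], each letter being paired with the part
   of [s ++ u] that follows it. *)
Fixpoint all_suffix (P : nat -> seq nat -> bool) (s u : seq nat) : bool :=
  if s is x :: s' then P x (s' ++ u) && all_suffix P s' u else true.

Definition stops (P : nat -> seq nat -> bool) (u : seq nat) : bool :=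
  if u is x :: u' then ~~ P x u' else true.

(** Both cuts lie at the first position where [P] fails, or at the end of the word. *)
Lemma all_suffix_unique P s u s' u' :
  all_suffix P s u -> stops P u -> all_suffix P s' u' -> stops P u' ->
  s ++ u = s' ++ u' -> s = s' /\ u = u'.
Proof.
elim: s s' => [|x s IH] [|x' s'] //=.
- by move=> _ su /andP[Px _] _ eu; rewrite eu /= Px in su.
- by move=> /andP[Px _] _ _ su eu; rewrite -eu /= Px in su.
- move=> /andP[_ As] su /andP[_ As'] su' [-> /(IH _ As su As' su')[-> ->]].
  by [].
Qed.

Lemma all_suffix_exists P w :
  exists s u, [/\ w = s ++ u, all_suffix P s u & stops P u].
Proof.
elim: w => [|x w [s [u [-> As su]]]]; first by exists [::], [::].
case Px: (P x (s ++ u)); first by exists (x :: s), u; rewrite /= Px.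
by exists [::], (x :: s ++ u); rewrite /= Px.
Qed.

(** * Monotone runs and decreases *)

Definition rises x u := ~~ falls x u.

(** The last letter of [s] drops strictly to [y], and the weak descent of [s] carries this back to
    every earlier position. *)
Lemma all_suffix_falls s y u :
  sorted geq s -> all (ltn y) s -> all_suffix falls s (y :: u).
Proof.
elim: s => //= a [|b s] IH /=; first by move=> _ /andP[->].
case/andP=> ba ss /andP[ya ys]; have /= /andP[fb ->] := IH ss ys.
by rewrite fb !andbT orbC -leq_eqVlt.
Qed.

Lemma all_suffix_rises s y u :
  sorted leq s -> all (gtn y) s -> all_suffix rises s (y :: u).
Proof.
elim: s => //= a [|b s] IH /=.
  by rewrite /rises /= => _ /andP[ay _]; rewrite ltnNge ltnW //= gtn_eqF.
case/andP=> ab ss /andP[ya ys]; have /= /andP[fb ->] := IH ss ys.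
by rewrite /rises /= ltnNge ab (negPf fb) andbF.
Qed.

Lemma all_suffix_rises_nil s : sorted leq s -> all_suffix rises s [::].
Proof.
elim: s => //= a [|b s] IH //= /andP[ab /IH /=/andP[fb ->]].
by rewrite /rises /= ltnNge ab (negPf fb) andbF.
Qed.

Lemma sorted_falls s u : all_suffix falls s u -> sorted geq s.
Proof.
elim: s => //= a [|b s] IH //= /andP[/orP ab /IH /= ->].
by rewrite andbT leq_eqVlt; case: ab => [->|/andP[->]]; rewrite ?orbT.
Qed.

Lemma sorted_rises s u : all_suffix rises s u -> sorted leq s.
Proof.
elim: s => //= a [|b s] IH //= /andP[]; rewrite /rises negb_or -leqNgt.
by move=> /andP[-> _] /IH.
Qed.

Lemma falls_count_falls s u :
  all_suffix falls s u -> falls_count (s ++ u) = size s + falls_count u.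
Proof. by elim: s => //= a s IH /andP[-> /IH->]. Qed.

Lemma falls_count_rises s u :
  all_suffix rises s u -> falls_count (s ++ u) = falls_count u.
Proof. by elim: s => //= a s IH /andP[/negPf-> /IH->]. Qed.

(** * V-words as products of two monotone words *)

(** The default [y.+1] makes the second hypothesis hold for empty [s], so the induction needs no
    separate nonemptiness assumption. *)
Lemma sorted_geq_last s y :
  sorted geq s -> y < last y.+1 s -> all (ltn y) s.
Proof.
elim: s => //= a [|b s] IH /=; first by move=> _ ->.
by case/andP=> ba ss /(IH ss) /= /andP[yb ->]; rewrite yb (leq_trans yb).
Qed.

Lemma sorted_leq_last s x : sorted leq s -> x \in s -> x <= last 0 s.
Proof.
case/lastP: s => // s c; rewrite (sorted_pairwise leq_trans) pairwise_rcons.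
rewrite last_rcons mem_rcons inE => /andP[/allP sc _] /predU1P[->//|/sc].
by [].
Qed.

(** Comparing the smallest letter of [A], its last, with the largest letter of [B], also its last,
    compares all pairs. *)
Lemma V_wordP v :
  reflect (exists A B, [/\ v = A ++ B, A != [::], B != [::],
             sorted geq A && sorted leq B & allrel ltn B A])
          (V_word v).
Proof.
apply: (iffP andP) => [[v2 /existsP[i /and5P[i0 sA ni sB lv]]]|].
- exists (take i v), (drop i v); rewrite cat_take_drop sA sB.
  have sizeA : size (take i v) = i by rewrite size_takel // ltnW.
  split=> //; rewrite -?size_eq0 ?sizeA -?lt0n ?size_drop ?subn_gt0 //.
  have lastB : last 0 (drop i v) = last 0 v.
    by rewrite -[in RHS](cat_take_drop i v) last_cat (drop_nth 0).
  apply/allP => b /(sorted_leq_last sB) bB; apply: sorted_geq_last => //.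
  rewrite -nth_last sizeA nth_take ?prednK //.
  rewrite (set_nth_default 0) ?(leq_ltn_trans (leq_pred _)) //.
  by apply: leq_ltn_trans lv; rewrite -lastB.
- case=> A [B [-> A0 B0 /andP[sA sB] BA]].
  have sizeA : 0 < size A by rewrite lt0n size_eq0.
  have sizeB : 0 < size B by rewrite lt0n size_eq0.
  have ltA : size A < size (A ++ B) by rewrite size_cat -ltn_subLR ?subnn.
  split; first by rewrite size_cat (leq_add sizeA sizeB).
  have lastA : nth 0 (A ++ B) (size A).-1 = last 0 A.
    by rewrite nth_cat ltn_predL sizeA nth_last.
  have lt_last b : b \in B -> b < last 0 A.
    move=> bB; apply: (allP (allP BA b bB)).
    by case: (A) A0 => //= a A' _; rewrite mem_last.
  apply/existsP; exists (Ordinal ltA).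
  rewrite /= take_size_cat // drop_size_cat // lastA sizeA sA sB /=.
  rewrite nth_cat ltnn subnn last_cat !lt_last ?mem_nth //.
  by case: (B) B0 => //= b B' _; rewrite mem_last.
Qed.

(** * Insertion of a V-word and its injectivity *)

(* With [c] the last letter of [B], this is B A u or B' A c u; the factors A and
   B are recovered from [v] since the decreases of [v] are the positions of A. *)
Definition insert (v u : seq nat) : seq nat :=
  let A := take (falls_count v) v in
  let B := drop (falls_count v) v in
  let k := size B - ~~ falls (last 0 B) u in
  take k B ++ A ++ drop k B ++ u.

Lemma perm_insert v u : perm_eq (insert v u) (v ++ u).
Proof.
rewrite /insert; set A := take _ v; set B := drop _ v; set k := _ - _.
rewrite -[in X in perm_eq _ X](cat_take_drop (falls_count v) v) -/A -/B.
by rewrite perm_catCA -catA perm_cat2l catA cat_take_drop.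
Qed.

Lemma V_word_falls A B :
  B != [::] -> sorted geq A && sorted leq B -> allrel ltn B A ->
  falls_count (A ++ B) = size A.
Proof.
case: B => // b B _ /andP[sA sB] /= /andP[bA _].
rewrite falls_count_falls ?all_suffix_falls //.
by rewrite -[b :: B]cats0 falls_count_rises ?addn0 // all_suffix_rises_nil.
Qed.

Definition dominating_falls (B : seq nat) (x : nat) (u : seq nat) : bool :=
  falls x u && all (gtn x) B.

(** Since [A] starts with a decrease, [B] is the longest prefix of non-decreases; the last two
    conditions make [A] maximal. *)
Definition factorization (B A t : seq nat) : Prop :=
  [/\ A != [::], all_suffix rises B (A ++ t),
      all_suffix (dominating_falls B) A t & stops (dominating_falls B) t].

Lemma factorization_unique B A t B' A' t' :
  factorization B A t -> factorization B' A' t' ->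
  B ++ A ++ t = B' ++ A' ++ t' -> [/\ B = B', A = A' & t = t'].
Proof.
case=> A0 rB fA st [A0' rB' fA' st'] e.
have stops_rises C D s : C != [::] -> all_suffix (dominating_falls D) C s ->
    stops rises (C ++ s).
  by case: C => //= c C _ /andP[/andP[fc _] _]; rewrite /rises negbK.
have [eB e'] := all_suffix_unique rB (stops_rises _ _ _ A0 fA) rB'
  (stops_rises _ _ _ A0' fA') e.
move: fA' st'; rewrite -eB => fA' st'.
by have [] := all_suffix_unique fA st fA' st' e'.
Qed.

Variant insert_spec (A B u : seq nat) : seq nat -> Prop :=
| InsertWhole of factorization B A u & falls (last 0 B) u :
    insert_spec A B u (B ++ A ++ u)
| InsertSplit B' c of B = rcons B' c & factorization B' A (c :: u)
    & ~~ falls c u :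
    insert_spec A B u (B' ++ A ++ c :: u).

Lemma all_suffix_dominating B A t :
  all_suffix falls A t -> allrel ltn B A -> all_suffix (dominating_falls B) A t.
Proof.
elim: A => //= a A IH /andP[fa fA]; rewrite allrel_consr => /andP[Ba BA].
by rewrite /dominating_falls fa IH // andbT.
Qed.

(** In both cases the letter after [A] lies below all of [A], so [A] consists of decreases. The run
    stops there: the next letter is at most [last 0 B] in the first case, and [c] is not a decrease
    in the second. *)
Lemma insertP A B u :
  A != [::] -> B != [::] -> sorted geq A && sorted leq B -> allrel ltn B A ->
  insert_spec A B u (insert (A ++ B) u).
Proof.
move=> A0 B0 sAB BA; rewrite /insert (V_word_falls B0 sAB BA).
have /andP[sA sB] := sAB.
rewrite take_size_cat // drop_size_cat //; case fB: falls => /=.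
- rewrite subn0 take_size drop_size; constructor=> //; split=> //.
  + case: A A0 {sA sAB} BA => // a A _; rewrite allrel_consr => /andP[Ba _].
    exact: all_suffix_rises.
  + apply: all_suffix_dominating => //.
    case: u fB => //= y u /orP yB; apply: all_suffix_falls => //.
    have lB : last 0 B \in B by case: (B) B0 => //= b B' _; rewrite mem_last.
    apply: sub_all (allP BA _ lB) => a /=; apply: leq_ltn_trans.
    by case: yB => [/ltnW //|/andP[/eqP->]].
  + case: u fB => //= y u /orP yB; apply/negP => /andP[_ /allP].
    have lB : last 0 B \in B by case: (B) B0 => //= b B' _; rewrite mem_last.
    move=> /(_ _ lB) /=; rewrite ltnNge.
    by case: yB => [/ltnW ->|/andP[/eqP->]]; rewrite ?leqnn.
- case/lastP: B B0 sB sAB BA fB => // B c _ sB _ BA; rewrite last_rcons => fc.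
  rewrite size_rcons subn1 /= -cats1 take_size_cat // drop_size_cat //= .
  move: BA; rewrite -cats1 allrel_catl => /andP[BA]; rewrite allrel1l => cA.
  constructor; rewrite ?cats1 ?fc //; split=> //.
  + case: A A0 {sA cA} BA => // a A _; rewrite allrel_consr => /andP[Ba _].
    apply: all_suffix_rises => //.
    by move: sB; rewrite !(sorted_pairwise leq_trans) pairwise_rcons => /andP[].
  + by apply: all_suffix_dominating => //; apply: all_suffix_falls.
  + by rewrite /= /dominating_falls fc.
Qed.

Lemma falls_count_factorization B A t :
  factorization B A t -> falls_count (B ++ A ++ t) = size A + falls_count t.
Proof.
case=> _ rB fA _; rewrite falls_count_rises // falls_count_falls //.
by elim: A {rB} fA => //= a A IH /andP[/andP[-> _] /IH].
Qed.

Lemma falls_count_insert v u :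
  V_word v -> falls_count (insert v u) = falls_count v + falls_count u.
Proof.
case/V_wordP=> A [B [-> A0 B0 sAB BA]]; rewrite (V_word_falls B0 sAB BA).
case: insertP => // [fac _|B' c _ fac fc]; rewrite falls_count_factorization //=.
by rewrite (negPf fc).
Qed.

Lemma falls_count_V_word v : V_word v -> 0 < falls_count v.
Proof.
case/V_wordP=> A [B [-> A0 B0 sAB BA]].
by rewrite (V_word_falls B0 sAB BA) lt0n size_eq0.
Qed.

Lemma insert_inj v u v' u' :
  V_word v -> V_word v' -> insert v u = insert v' u' -> v = v' /\ u = u'.
Proof.
case/V_wordP=> A [B [-> A0 B0 sAB BA]] /V_wordP[A' [B' [-> A0' B0' sAB' BA']]].
(* Excludes images of different kinds: [c] is at least every letter of [C] and is no decrease, so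
   the last letter of [C] is none either. For empty [C] the default 0 cannot exceed [c]. *)
have mixed C c s : sorted leq (rcons C c) -> falls (last 0 C) (c :: s) ->
    ~~ falls c s -> False.
  rewrite (sorted_pairwise leq_trans) pairwise_rcons => /andP[/allP Cc _] /=.
  case/orP=> [|/andP[_ ->]//]; case: C Cc => //= b C Cc.
  by rewrite ltnNge Cc ?mem_last.
have /andP[_ sB] := sAB; have /andP[_ sB'] := sAB'.
case: insertP => // [f fB|C c eB f fc];
  case: insertP => // [f' fB'|C' c' eB' f' fc']; case/(factorization_unique f f').
- by move=> -> -> ->.
- by move=> eC _ eu; case: (mixed C' c' u'); rewrite -?eB' -?eC -?eu.
- by move=> eC _ eu; case: (mixed C c u); rewrite -?eB ?eC ?eu.
- by move=> eC -> [ec ->]; rewrite eB eB' eC ec.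
Qed.

(** * Surjectivity of insertion onto words that are not nondecreasing *)

(** A non-decrease just before the decrease [x] must be a strict ascent, and [B] is nondecreasing up
    to there. *)
Lemma rises_lt_falls B x u :
  all_suffix rises B (x :: u) -> falls x u -> all (gtn x) B.
Proof.
move=> rB fx; elim: B rB => //= b [|b' B] IH /andP[rb rB].
  by move: rb; rewrite /rises /= fx andbT orbC -leq_eqVlt -ltnNge andbT.
have := IH rB; rewrite /= => /andP[b'x ->]; rewrite b'x !andbT.
by move: rb; rewrite /rises /= negb_or -leqNgt => /andP[/leq_ltn_trans ->].
Qed.

(** If the letter after [A] equalled the last letter of [A], it would be a dominating decrease too,
    against maximality. *)
Lemma dominating_falls_gt B A t :
  A != [::] -> all_suffix (dominating_falls B) A t ->
  stops (dominating_falls B) t ->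
  exists c t', t = c :: t' /\ all (ltn c) A.
Proof.
move=> + + st; elim: A => //= a [|b A] IH _ /andP[/andP[fa Ba] fA].
  case: t st fa {IH fA} => //= c t st /orP[ca|/andP[/eqP ca fc]].
    by exists c, t; rewrite ca.
  by rewrite /dominating_falls fc ca Ba in st.
have [//|c [t' [-> /= /andP[cb cA]]]] := IH _ fA.
exists c, t'; rewrite cb cA (leq_trans cb) //.
by move: fa => /= /orP[/ltnW//|/andP[/eqP->]].
Qed.

Lemma all_suffix_dominating_falls B A t :
  all_suffix (dominating_falls B) A t -> all_suffix falls A t /\ allrel ltn B A.
Proof.
elim: A => [_|a A IH] /=; first by rewrite allrel0r.
by move=> /andP[/andP[-> Ba] /IH[-> BA]]; rewrite allrel_consr Ba.
Qed.

Lemma unsorted_factorization w :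
  ~~ sorted leq w -> exists B A t, w = B ++ A ++ t /\ factorization B A t.
Proof.
have [B [s [-> rB ss]]] := all_suffix_exists rises w => nsw.
have [A [t [es fA st]]] := all_suffix_exists (dominating_falls B) s.
exists B, A, t; rewrite /factorization -es; split=> //; split=> //.
(* With [A] empty, either nothing follows [B] and the word is nondecreasing, or the next letter is a
   decrease exceeding all of [B], so the run could not stop. *)
case: A es fA => //= st_; case: s => [|x s] in rB ss nsw st_ *.
  by rewrite cats0 (sorted_rises rB) in nsw.
move: ss st; rewrite -st_ /= negbK /dominating_falls => fx.
by rewrite fx (rises_lt_falls rB).
Qed.

Lemma unsorted_insert w :
  ~~ sorted leq w -> exists v u, V_word v /\ w = insert v u.
Proof.
case/unsorted_factorization=> B [A [t [-> fac]]]; case: (fac) => A0 rB fA st.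
have [c [t' [et cA]]] := dominating_falls_gt A0 fA st; subst t.
have [{}fA BA] := all_suffix_dominating_falls fA.
have sA := sorted_falls fA; have sB := sorted_rises rB.
case: (boolP ((B != [::]) && falls (last 0 B) (c :: t'))) => [/andP[B0 fB]|nfB].
  have sAB : sorted geq A && sorted leq B by rewrite sA.
  exists (A ++ B), (c :: t'); split; first by apply/V_wordP; exists A, B.
  by case: insertP fB => // B' c' -> _; rewrite last_rcons => /negPf->.
(* Here [c] returns to the end of [B]. Were it a decrease, it would differ from [last 0 B], hence
   exceed all of [B] and prolong the run [A]. *)
have [Bc fc] : all (geq c) B /\ ~~ falls c t'.
  have [B_nil|B0] := eqVneq B [::].
    by move: st; rewrite B_nil /= /dominating_falls andbT.
  move: nfB; rewrite B0 /= negb_or -leqNgt => /andP[Bc ncB].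
  have leBc : all (geq c) B.
    by apply/allP=> b bB; apply: leq_trans (sorted_leq_last sB bB) Bc.
  split=> //; apply/negP => fc; move: ncB st; rewrite fc andbT /= => ncB.
  rewrite /dominating_falls fc => /negP; apply; apply/allP=> b bB.
  by apply: leq_ltn_trans (sorted_leq_last sB bB) _; rewrite ltn_neqAle eq_sym ncB.
have sAB : sorted geq A && sorted leq (rcons B c).
  move: sB; rewrite sA !(sorted_pairwise leq_trans) pairwise_rcons => ->.
  by rewrite andbT.
have B0 : rcons B c != [::] by case: (B).
have BcA : allrel ltn (rcons B c) A.
  by rewrite -cats1 allrel_catl BA allrel1l.
exists (A ++ rcons B c), t'; split; first by apply/V_wordP; exists A, (rcons B c).
case: insertP => //; first by rewrite last_rcons (negPf fc).
by move=> B' c' /rcons_inj[<- <-].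
Qed.

(** * Iterated insertion and the bijection *)

Definition assemble (p : seq nat * seq (seq nat)) : seq nat :=
  foldr insert p.1 p.2.

Lemma perm_assemble p : perm_eq (assemble p) (p.1 ++ flatten p.2).
Proof.
case: p => w0 vs; rewrite /assemble /=; elim: vs => [|v vs IH] /=.
  by rewrite cats0.
by rewrite (perm_trans (perm_insert _ _)) // perm_sym perm_catCA perm_cat2l perm_sym.
Qed.

Lemma falls_count_sorted w : sorted leq w -> falls_count w = 0.
Proof.
by move=> sw; rewrite -[w]cats0 falls_count_rises // all_suffix_rises_nil.
Qed.

Lemma dec_assemble p :
  sorted leq p.1 -> all V_word p.2 -> dec (assemble p) = \sum_(v <- p.2) dec v.
Proof.
case: p => w0 vs /= sw; rewrite dec_falls_count /assemble /=.
elim: vs => [_|v vs IH] /=; first by rewrite big_nil falls_count_sorted.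
case/andP=> Vv /IH IHvs.
by rewrite falls_count_insert // IHvs big_cons dec_falls_count.
Qed.

Lemma assemble_inj p p' :
  sorted leq p.1 -> all V_word p.2 -> sorted leq p'.1 -> all V_word p'.2 ->
  assemble p = assemble p' -> p = p'.
Proof.
case: p p' => w vs [w' vs'] /= + + + +; rewrite /assemble /=.
(* Insertion creates a decrease and a nondecreasing word has none, so both sequences have the same
   number of V-words. *)
have insert_unsorted v u s : V_word v -> sorted leq s -> insert v u <> s.
  move=> Vv ss e; have := falls_count_V_word Vv.
  have := falls_count_insert u Vv.
  by rewrite e falls_count_sorted //; case: falls_count.
elim: vs vs' => [|v vs IH] [|v' vs'] //=; first by move=> _ _ _ _ ->.
- by move=> sw _ _ /andP[Vv _] /esym /(insert_unsorted _ _ _ Vv sw).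
- by move=> _ /andP[Vv _] sw _ /(insert_unsorted _ _ _ Vv sw).
- move=> sw /andP[Vv Vvs] sw' /andP[Vv' Vvs'] /(insert_inj Vv Vv')[-> e].
  by case: (IH vs' sw Vvs sw' Vvs' e) => -> ->.
Qed.

Lemma assemble_surj w :
  exists p, [/\ sorted leq p.1, all V_word p.2 & assemble p = w].
Proof.
have [n] := ubnP (size w); elim: n w => // n IH w /ltnSE wn.
have [sw|] := boolP (sorted leq w); first by exists (w, [::]).
case/unsorted_insert=> v [u [Vv ew]].
have [|[w0 vs] /= [sw Vvs eu]] := IH u.
  have v0 : 0 < size v by case/andP: Vv => /ltnW.
  apply: leq_trans wn; rewrite ew (perm_size (perm_insert v u)) size_cat.
  by rewrite -[ltnLHS]add0n ltn_add2r.
by exists (w0, v :: vs); rewrite /= Vv /assemble /= -/(assemble (w0, vs)) eu.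
Qed.

(** Length and letter bound are invariant under rearrangement, so they can be tested on the
    assembled word. *)
Lemma V_sequencesE r n p :
  V_sequences r n p =
  [&& sorted leq p.1, all V_word p.2 & words r n (assemble p)].
Proof.
have pp := perm_assemble p.
rewrite /V_sequences /words (perm_size pp) (perm_all _ pp) all_cat size_cat.
rewrite size_flatten sumnE big_map all_predI.
have -> : all (all (leq^~ r)) p.2 = all (leq^~ r) (flatten p.2).
  by elim: (p.2) => //= v vs ->; rewrite all_cat.
by case: sorted; case: all; case: all; case: all; case: eqP.
Qed.

Theorem theorem3p4 (r n : nat) :
  exists f : {w : seq nat | words r n w} ->
             {p : seq nat * seq (seq nat) | V_sequences r n p},
    bijective f /\
    forall w : {w : seq nat | words r n w},
      perm_eq ((val (f w)).1 ++ flatten (val (f w)).2) (val w) /\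
      dec (val w) = \sum_(v <- (val (f w)).2) dec v.
Proof.
(* The map [f] chooses a preimage under [assemble]; injectivity makes it a two-sided inverse. *)
have disassemble (w : {w | words r n w}) :
    exists p : {p | V_sequences r n p}, assemble (val p) == val w.
  have [p [sp Vp ep]] := assemble_surj (val w).
  have Vsp : V_sequences r n p by rewrite V_sequencesE sp Vp ep (valP w).
  by exists (exist _ p Vsp); apply/eqP.
pose f w := xchoose (disassemble w).
have fK w : assemble (val (f w)) = val w.
  by apply/eqP; exact: (xchooseP (disassemble w)).
have words_assemble (p : {p | V_sequences r n p}) : words r n (assemble (val p)).
  by have := valP p; rewrite V_sequencesE => /and3P[].
pose g p : {w | words r n w} := exist (words r n) _ (words_assemble p).
exists f; split=> [|w].
  exists g => [w|p]; apply: val_inj; first exact: fK.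
  have /and3P[sp Vp _] := etrans (esym (V_sequencesE _ _ _)) (valP p).
  have /and3P[sf Vf _] :=
    etrans (esym (V_sequencesE _ _ _)) (valP (f (g p))).
  by apply: assemble_inj => //; apply: fK.
have := valP (f w); rewrite V_sequencesE => /and3P[sf Vf _].
by rewrite -(fK w) perm_sym perm_assemble dec_assemble.
Qed.
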